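(* Let $j\ge\tfrac12$ be an integer or half-integer. (1) For $s'\in[0,1)$, the function $\widehat T(\xi,\eta)=c\,(\bar\xi\eta+s')^{2j}$ with $c=\sqrt{\frac{1-s'^2}{1-s'^{4j+2}}}$ is the Wick symbol of $T=\sqrt\rho$, where $\rho$ is the density operator $$\rho=\frac{1-s'^2}{1-s'^{4j+2}}\sum_{m=-j}^{j}s'^{\,2(j-m)}|j,m\rangle\langle j,m| .$$ (2) For $k>0$ and $n\in\{-j,-j+1,\dots,j\}$, let $|\varphi_n\rangle=A_n\,e^{-\frac12\ln k\,J_z}\,e^{-\frac{i\pi}{2}J_y}|j,n\rangle$, with $A_n$ a normalization constant. Then the Wick symbol of $|\varphi_n\rangle\langle\varphi_n|$ is $$\widehat T(\xi,\eta)=c\,(\bar\xi+\sqrt{k})^{j+n}(\bar\xi-\sqrt{k})^{j-n}(\eta+\sqrt{k})^{j+n}(\eta-\sqrt{k})^{j-n}$$ for some constant $c$.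
   Context: Spin-$j$ system: $J_x,J_y,J_z$ are the Hermitian generators of the irreducible $(2j+1)$-dimensional representation of $\mathfrak{su}(2)$ on $\mathbb C^{2j+1}$, with $[J_x,J_y]=iJ_z$, $[J_y,J_z]=iJ_x$, $[J_z,J_x]=iJ_y$, and $J_\pm=J_x\pm iJ_y$. The Dicke states $|j,m\rangle$, $m=-j,\dots,j$, are the orthonormal basis with $J_z|j,m\rangle=m|j,m\rangle$, $J_+|j,m\rangle=\sqrt{(j-m)(j+m+1)}\,|j,m+1\rangle$, $J_-|j,m\rangle=\sqrt{(j+m)(j-m+1)}\,|j,m-1\rangle$. For $\xi\in\mathbb C$ the unnormalized coherent state is $\|\xi\rangle=\sum_{m=-j}^j\sqrt{\binom{2j}{j+m}}\,\xi^{j+m}|j,m\rangle$, and the Wick symbol of an operator $T$ is $\widehat T(\xi,\eta)=\langle\xi\|T\|\eta\rangle$. Convention: $0^0=1$. *)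

(* Defs.v *)
From HB Require Import structures.
From mathcomp Require Import all_boot all_order all_algebra.
From mathcomp Require Import complex.
From mathcomp Require Import all_classical all_reals all_analysis.
Import Order.TTheory GRing.Theory Num.Theory.
Import numFieldNormedType.Exports.

Set Implicit Arguments.
Unset Strict Implicit.
Unset Printing Implicit Defensive.

Local Open Scope ring_scope.
Local Open Scope classical_set_scope.
Local Open Scope sesquilinear_scope.

(* The limit is taken for the canonical (sup-norm) topology of matrices. *)
Definition expmx (K : numFieldType) (n : nat) (A : 'M[K]_n.+1) : 'M[K]_n.+1 :=
  limn (series (fun k => k`!%:R^-1 *: A ^+ k)).

Section Operators.
Variables (C : numClosedFieldType) (n : nat).
Implicit Types (A : 'M[C]_n) (u v : 'cV[C]_n).

(* <u|v>, antilinear in u. *)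
Definition braket u v : C := (u^t* *m v) 0 0.

Definition ketbra u v : 'M[C]_n := u *m v^t*.

Definition is_psd A : Prop :=
  A \is hermsymmx /\ forall v, 0 <= braket v (A *m v).

Definition is_density A : Prop := is_psd A /\ \tr A = 1.

(* Functional calculus: the square root of each eigenvalue in an orthonormal
   eigenbasis. It is meaningful for positive semidefinite [A] only; see
   [sqrtmx_psd] and [sqrtmx_square]. *)
Definition sqrtmx A : 'M[C]_n :=
  invmx (spectralmx A) *m diag_mx (map_mx sqrtC (spectral_diag A))
    *m spectralmx A.

Lemma sqrtmx_square A : is_psd A -> sqrtmx A *m sqrtmx A = A.
Proof.
move=> [Ah _]; have /orthomx_spectralP AE := hermitian_normalmx Ah.
rewrite [RHS]AE /sqrtmx -!mulmxA mulKVmx ?spectral_unit//.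
congr (_ *m _); rewrite !mulmxA; congr (_ *m _).
rewrite mulmx_diag; congr diag_mx; apply/rowP => i.
by rewrite !mxE -expr2 sqrtCK.
Qed.

Lemma spectral_diag_ge0 A i : is_psd A -> 0 <= spectral_diag A 0 i.
Proof.
move=> [Ah A0]; have /orthomx_spectralP AE := hermitian_normalmx Ah.
have UE := invmx_unitary (spectral_unitarymx A).
have := A0 ((spectralmx A)^t* *m delta_mx i 0).
rewrite /braket trmx_mul map_mxM trmxCK trmx_delta map_delta_mx -UE {2}AE.
rewrite !mulmxA mulmxK ?spectral_unit// mulmxK ?spectral_unit//.
by rewrite -mulmxA -rowE -colE !mxE eqxx.
Qed.

Lemma sqrtmx_psd A : is_psd A -> is_psd (sqrtmx A).
Proof.
move=> Apsd; set D := map_mx sqrtC (spectral_diag A).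
have D0 i : 0 <= D 0 i by rewrite mxE sqrtC_ge0 spectral_diag_ge0.
have sE : sqrtmx A = (spectralmx A)^t* *m diag_mx D *m spectralmx A.
  by rewrite /sqrtmx invmx_unitary ?spectral_unitarymx.
have DC : map_mx Num.conj D = D.
  by apply/rowP => i; rewrite [LHS]mxE; apply/CrealP/ger0_real.
split.
  apply/is_hermitianmxP; rewrite expr0 scale1r sE.
  rewrite !trmx_mul !map_mxM /= trmxCK tr_diag_mx map_diag_mx DC.
  by rewrite mulmxA.
move=> v; rewrite /braket sE !mulmxA -mulmxA.
have -> : v^t* *m (spectralmx A)^t* = (spectralmx A *m v)^t*.
  by rewrite trmx_mul map_mxM.
move: (spectralmx A *m v) => w; rewrite mxE sumr_ge0// => i _.
have -> : (w^t* *m diag_mx D) 0 i * w i 0 = D 0 i * (w i 0 * (w i 0)^*).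
  by rewrite mul_mx_diag !mxE mulrAC mulrC [_^* * _]mulrC.
by rewrite mulr_ge0// mul_conjC_ge0.
Qed.

End Operators.

(* The spin is j = N / 2, so that the space C^(2j+1) has dimension N + 1. The
   index a : 'I_N.+1 stands for the magnetic number m = a - j; in other words
   j + m = a and j - m = N - a. *)
Section Spin.
Variables (C : numClosedFieldType) (N : nat).
Implicit Types (a b : 'I_N.+1) (T : 'M[C]_N.+1).

Definition spin : C := N%:R / 2.

Definition mag a : C := a%:R - spin.

Definition dicke a : 'cV[C]_N.+1 := delta_mx a 0.

(* Entry (b, a) of an operator is <b|.|a>, so column a is the image of |a>. *)
Definition Jz : 'M[C]_N.+1 := \matrix_(b, a) (if b == a then mag a else 0).

Definition Jplus : 'M[C]_N.+1 := \matrix_(b, a)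
  (if b == a.+1 :> nat then sqrtC ((spin - mag a) * (spin + mag a + 1)) else 0).

Definition Jminus : 'M[C]_N.+1 := \matrix_(b, a)
  (if b.+1 == a :> nat then sqrtC ((spin + mag a) * (spin - mag a + 1)) else 0).

(* J_x and J_y are recovered from J_+ = J_x + i J_y and J_- = J_x - i J_y. *)
Definition Jx : 'M[C]_N.+1 := 2^-1 *: (Jplus + Jminus).

Definition Jy : 'M[C]_N.+1 := (2 * 'i)^-1 *: (Jplus - Jminus).

(* [0 ^+ 0 = 1] in [ring_scope]. *)
Definition coherent (xi : C) : 'cV[C]_N.+1 :=
  \sum_(a < N.+1) (sqrtC 'C(N, a)%:R * xi ^+ a) *: dicke a.

Definition wick T (xi eta : C) : C :=
  braket (coherent xi) (T *m coherent eta).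

End Spin.

Arguments dicke C {N} a.
Arguments Jx C N : clear implicits.
Arguments Jy C N : clear implicits.
Arguments Jz C N : clear implicits.

(* 4j + 2 = 2N + 2 and 2(j - m) = 2(N - a). *)
Definition rho (R : realType) (N : nat) (s : R) : 'M[R[i]]_N.+1 :=
  ((1 - s ^+ 2) / (1 - s ^+ (2 * N + 2)))%:C%C *: \sum_(a < N.+1)
    (s ^+ (2 * (N - a)))%:C%C *: ketbra (dicke R[i] a) (dicke R[i] a).

(* The index [n] labels the Dicke state of magnetic number [mag n]. *)
Definition phi (R : realType) (N : nat) (k : R) (A : R[i]) (n : 'I_N.+1) :
    'cV[R[i]]_N.+1 :=
  A *: (expmx ((- (2^-1 * ln k))%:C%C *: Jz R[i] N)
        *m expmx (- ('i * pi%:C%C / 2) *: Jy R[i] N)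
        *m dicke R[i] n).

(* Main.v *)
Require Import Defs.
From HB Require Import structures.
From mathcomp Require Import all_boot all_order all_algebra.
From mathcomp Require Import complex.
From mathcomp Require Import all_classical all_reals all_analysis.
From mathcomp Require Import ring.
Import Order.TTheory GRing.Theory Num.Theory.
Import numFieldNormedType.Exports.
Local Open Scope ring_scope.

Set Implicit Arguments.
Unset Strict Implicit.
Unset Printing Implicit Defensive.

(* Part (1): rho is diagonal in the Dicke basis, so its square root is read off
   entrywise and the symbol is a binomial expansion.

   Part (2): the Bargmann transform sends |a> to sqrt(C(N, a)) X^a; then
   <xi|v> is the value at conj(xi) of the transform of v, J_- acts as d/dX and
   J_+ as N X - X^2 d/dX. The polynomials (X + i)^a (X - i)^(N - a) are
   eigenvectors of J_+ - J_-, so that exp(- i pi/2 J_y) rotates X + i and X - i by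
   opposite angles pi/4. Writing X^n, as a form of degree N, in terms of X + i and
   X - i shows that it is sent to a multiple of (X + 1)^n (X - 1)^(N - n).
   Finally exp(- ln k / 2 J_z) rescales X by 1 / sqrt k. *)

(** * Exponential of a diagonalizable matrix *)

Section Exponential.
Local Open Scope classical_set_scope.

(* A structure-typed [K] triggers the topology attached to [numFieldType];
   it is not found on the concrete type [R[i]]. *)
Definition cvg_seq (K : numFieldType) (u : nat -> K) (l : K) : Prop :=
  u @ \oo --> l.

Definition exps (K : numFieldType) (x : K) : nat -> K :=
  fun m => \sum_(0 <= k < m) k`!%:R^-1 * x ^+ k.

Lemma cvg_real_complex (R : realType) (u : R^nat) (l : R) :
  u @ \oo --> l -> cvg_seq (fun m => (u m)%:C%C : R[i]) (l%:C%C : R[i]).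
Proof.
move=> /cvgrPdist_lt ul; rewrite /cvg_seq; apply/cvgrPdist_lt => e e0.
have /complex_realP [r eE] : (e : R[i]) \is Num.real := gtr0_real e0.
move: e0; rewrite eE ltcR => r0.
apply: filterS (ul _ r0) => m.
by rewrite -rmorphB /= normc_def /= expr0n addr0 sqrtr_sqr ltcR.
Qed.

Lemma cvg_exps_real (R : realType) (x : R) :
  cvg_seq (exps (x%:C%C : R[i])) (expR x)%:C%C.
Proof.
have -> : exps (x%:C%C : R[i]) = fun m => (series (exp_coeff x) m)%:C%C.
  apply/funext => m; rewrite /exps /series /= rmorph_sum; apply: eq_bigr => k _.
  by rewrite /exp_coeff /= mulrC rmorphM rmorphXn fmorphV rmorph_nat.
by apply: cvg_real_complex; exact: is_cvg_series_exp_coeff.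
Qed.

(** Since ['i ^+ h.*2 = (-1) ^+ h], the even terms form the cosine series and the odd terms ['i]
    times the sine series. *)
Lemma cvg_exps_imaginary (R : realType) (y : R) :
  cvg_seq (exps ((0 +i* y)%C : R[i])) (cos y +i* sin y)%C.
Proof.
have -> : exps ((0 +i* y)%C : R[i]) =
    fun m => (series (cos_coeff y) m)%:C%C + 'i%C * (series (sin_coeff y) m)%:C%C.
  apply/funext => m; rewrite /exps /series /= 2!rmorph_sum mulr_sumr -big_split.
  apply: eq_bigr => k _ /=.
  have -> : (0 +i* y)%C = 'i%C * (y%:C)%C by simpc.
  have iM h : ('i%C : R[i]) ^+ h.*2 = ((-1) ^+ h)%:C%C.
    by rewrite -mul2n exprM sqr_i rmorphXn rmorphN1.
  rewrite exprMn -rmorphXn /cos_coeff /sin_coeff /= -(rmorph_nat (real_complex R)) -fmorphV.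
  have := odd_double_half k; case: (odd k) => /= kE.
    (* The sine coefficients carry the sign exponent [k.-1./2], which is [k./2] for odd [k]. *)
    have -> : k.-1./2 = k./2 by rewrite -[in LHS]kE /= doubleK.
    rewrite -[in 'i%C ^+ k]kE add1n exprS iM !mul0r mul1r add0r !rmorphM /=.
    by ring.
  rewrite -[in 'i%C ^+ k]kE add0n iM mul1r !mul0r mulr0 addr0 !rmorphM /=.
  by ring.
rewrite [X in cvg_seq _ X]complexE; apply: cvgD.
  by apply: cvg_real_complex; rewrite cos.unlock; exact: is_cvg_series_cos_coeff.
apply: cvgM; [exact: cvg_cst|]; apply: cvg_real_complex; rewrite sin.unlock.
exact: is_cvg_series_sin_coeff.
Qed.

(** In terms of the fixed rank-one matrices [col a X *m row a D], the partial sums have the scalar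
    coefficients [exps (l 0 a) m], so only scalar limits are needed. *)
Lemma expmx_diagonalized (K : numFieldType) (n : nat) (G X D : 'M[K]_n.+1)
    (l e : 'rV[K]_n.+1) :
  G *m X = X *m diag_mx l -> X *m D = 1%:M ->
  (forall a, cvg_seq (exps (l 0 a)) (e 0 a)) ->
  expmx G = X *m diag_mx e *m D.
Proof.
move=> GX XD le.
have GE k : G ^+ k *m X = X *m diag_mx (map_mx (fun x => x ^+ k) l).
  elim: k => [|k IHk].
    rewrite expr0 mul1mx [X in _ *m X](_ : _ = 1%:M) ?mulmx1 //.
    by apply/matrixP => i j; rewrite !mxE expr0.
  rewrite exprSr -mulmxA GX mulmxA IHk -mulmxA mulmx_diag; congr (_ *m diag_mx _).
  by apply/rowP => i; rewrite !mxE exprSr.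
have decE (d : 'rV[K]_n.+1) :
    X *m diag_mx d *m D = \sum_a d 0 a *: (col a X *m row a D).
  apply/matrixP => i j; rewrite !mxE summxE; apply: eq_bigr => a _.
  by rewrite mul_mx_diag !mxE big_ord1 !mxE mulrA [d 0 a * _]mulrC.
rewrite /expmx decE.
have -> : series (fun k => k`!%:R^-1 *: G ^+ k) =
    fun m => \sum_a exps (l 0 a) m *: (col a X *m row a D).
  apply/funext => m; rewrite /series /=.
  transitivity (\sum_a (\row_a exps (l 0 a) m) 0 a *: (col a X *m row a D));
    last by apply: eq_bigr => a _; rewrite mxE.
  (* Inserting [X *m D] on the right puts an [X] after each power of [G], where [GE] applies. *)
  rewrite -decE -[LHS]mulmx1 -XD mulmxA; congr (_ *m _).
  rewrite mulmx_suml; under eq_bigr do rewrite -scalemxAl GE scalemxAr.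
  rewrite -mulmx_sumr; congr (_ *m _).
  apply/matrixP => i j; rewrite summxE !mxE /exps /series /=.
  rewrite -sumrMnl; apply: eq_bigr => k _.
  by rewrite !mxE mulrnAr.
apply: cvg_lim; first exact: norm_hausdorff.
apply: cvg_big => [|a _]; first exact: add_continuous.
apply: cvgZr_tmp; exact: le.
Qed.

End Exponential.

(** * Square roots of nonnegative reals and of diagonal matrices *)

Lemma sqrtC_real_complex (R : realType) (x : R) : 0 <= x ->
  sqrtC (x%:C%C : R[i]) = (Num.sqrt x)%:C%C.
Proof.
move=> x0; rewrite -{1}(sqr_sqrtr x0) rmorphXn /= sqrCK //.
by rewrite ler0c sqrtr_ge0.
Qed.

Section Diagonal.
Variables (C : numClosedFieldType) (n : nat).
Implicit Types d : 'rV[C]_n.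

Lemma is_psd_diag_mx d : (forall a, 0 <= d 0 a) -> is_psd (diag_mx d).
Proof.
move=> d0; split.
  apply/is_hermitianmxP; rewrite expr0 scale1r tr_diag_mx map_diag_mx.
  congr diag_mx; apply/rowP => a; rewrite [RHS]mxE.
  by apply/esym/CrealP/ger0_real.
move=> v; rewrite /braket mulmxA mxE sumr_ge0 // => a _.
by rewrite mul_mx_diag !mxE mulrAC mulr_ge0 // mulrC mul_conjC_ge0.
Qed.

(* Conjugation by the spectral basis U intertwines the two diagonal matrices:
   a nonzero entry of U forces the corresponding eigenvalues to agree, hence
   also their square roots. *)
Lemma sqrtmx_diag_mx d : sqrtmx (diag_mx d) = diag_mx (map_mx sqrtC d).
Proof.
set A := diag_mx d; set U := spectralmx A; set D := spectral_diag A.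
have An : A \is normalmx.
  by apply/normalmxP; rewrite tr_diag_mx map_diag_mx !mulmx_diag;
    congr diag_mx; apply/rowP => a; rewrite !mxE mulrC.
have Uu : U \in unitmx := spectral_unit A.
have UA : U *m A = diag_mx D *m U.
  by have /orthomx_spectralP {1}-> := An; rewrite -mulmxA mulKVmx.
rewrite /sqrtmx -/U -/D -mulmxA.
suff -> : diag_mx (map_mx sqrtC D) *m U = U *m diag_mx (map_mx sqrtC d).
  by rewrite mulKmx.
apply/matrixP => i j; move/matrixP/(_ i j): UA.
rewrite mul_mx_diag mul_diag_mx mul_mx_diag mul_diag_mx !mxE [U i j * sqrtC _]mulrC.
rewrite [U i j * _]mulrC => /eqP; rewrite -subr_eq0 -mulrBl mulf_eq0 subr_eq0.
by move=> /orP[/eqP <- //|/eqP ->]; rewrite !mulr0.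
Qed.

End Diagonal.

(** * Bargmann transform, ladder operators and homogenization *)

Section Bargmann.
Variables (C : numClosedFieldType) (N : nat).
Implicit Types (a b : 'I_N.+1) (v : 'cV[C]_N.+1) (p q : {poly C}).

Local Notation binC a := (sqrtC ('C(N, a)%:R : C)).

Lemma coherentE (xi : C) a : coherent N xi a 0 = binC a * xi ^+ a.
Proof.
rewrite summxE (bigD1 a) //= big1 => [|b ba]; rewrite !mxE ?eqxx ?mulr1 ?addr0 //.
by rewrite eq_sym (negPf ba) mulr0.
Qed.

Lemma conj_binC (a : nat) : (binC a)^* = binC a.
Proof. by apply/CrealP/ger0_real; rewrite sqrtC_ge0 ler0n. Qed.

Lemma binC_neq0 a : binC a != 0.
Proof. by rewrite sqrtC_eq0 pnatr_eq0 -lt0n bin_gt0 -ltnS. Qed.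

Lemma wick_diag_mx (d : 'rV[C]_N.+1) (xi eta : C) :
  wick (diag_mx d) xi eta = \sum_a d 0 a * (xi^* * eta) ^+ a *+ 'C(N, a).
Proof.
rewrite /wick /braket mulmxA mxE; apply: eq_bigr => a _.
rewrite mul_mx_diag !mxE !coherentE rmorphM rmorphXn /= conj_binC exprMn.
rewrite -[RHS]mulr_natr -[in RHS](sqrtCK ('C(N, a)%:R)).
by ring.
Qed.

Definition bargmann v : {poly C} :=
  \poly_(a < N.+1) (binC a * v (inord a) 0).

Lemma coef_bargmann v a : (bargmann v)`_a = binC a * v a 0.
Proof. by rewrite coef_poly ltn_ord inord_val. Qed.

Lemma size_bargmann v : (size (bargmann v) <= N.+1)%N.
Proof. exact: size_poly. Qed.

Lemma bargmann_is_linear : linear bargmann.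
Proof.
move=> c v w; apply/polyP => k; rewrite coefD coefZ !coef_poly.
case: ifP => _; rewrite ?mulr0 ?addr0 // !mxE; ring.
Qed.

HB.instance Definition _ := GRing.isLinear.Build C 'cV[C]_N.+1 {poly C} *:%R
  bargmann bargmann_is_linear.

Lemma eq_poly_ord p q : (size p <= N.+1)%N -> (size q <= N.+1)%N ->
  (forall a, p`_a = q`_a) -> p = q.
Proof.
move=> sp sq pq; apply/polyP => k; case: (ltnP k N.+1) => kN.
  exact: (pq (Ordinal kN)).
by rewrite !nth_default // (leq_trans _ kN).
Qed.

Lemma bargmann_inj : injective bargmann.
Proof.
move=> v w vw; apply/colP => a.
by apply: (mulfI (binC_neq0 a)); rewrite -!coef_bargmann vw.
Qed.

Definition unbargmann p : 'cV[C]_N.+1 := \col_a (p`_a / binC a).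

Lemma unbargmannK p : (size p <= N.+1)%N -> bargmann (unbargmann p) = p.
Proof.
move=> sp; apply: eq_poly_ord (size_bargmann _) sp _ => a.
by rewrite coef_bargmann mxE mulrC divfK // binC_neq0.
Qed.

Lemma bargmann_dicke b : bargmann (dicke C b) = binC b *: 'X^b.
Proof.
apply: eq_poly_ord (size_bargmann _) _ _ => [|a].
  by rewrite (leq_trans (size_scale_leq _ _)) // size_polyXn ltn_ord.
rewrite coef_bargmann coefZ coefXn mxE andbT val_eqE.
by case: eqVneq => [->|_]; rewrite ?mulr0.
Qed.

Lemma braket_coherent (xi : C) v : braket (coherent N xi) v = (bargmann v).[xi^*].
Proof.
rewrite /braket mxE horner_poly; apply: eq_bigr => a _.
by rewrite !mxE coherentE rmorphM rmorphXn /= conj_binC inord_val mulrAC.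
Qed.

(** The symbol factors as the bracket of [coherent N xi] with [v] times the conjugate of the bracket
    of [coherent N eta] with [v]. *)
Lemma wick_ketbra v (xi eta : C) :
  wick (ketbra v v) xi eta = (bargmann v).[xi^*] * ((bargmann v).[eta^*])^*.
Proof.
rewrite -!braket_coherent /wick /ketbra /braket !mulmxA -mulmxA.
rewrite [LHS]mxE big_ord1; congr (_ * _).
by rewrite !mxE rmorph_sum; apply: eq_bigr => a _; rewrite !mxE rmorphM /= conjCK mulrC.
Qed.

Lemma spinDmag a : spin C N + mag C a = a%:R.
Proof. by rewrite /mag addrC subrK. Qed.

Lemma spinBmag a : spin C N - mag C a = N%:R - a%:R.
Proof. by rewrite /mag /spin; field. Qed.

(** Under a single root, the identity (k+1) C(N, k+1) = (N-k) C(N, k) produces C(N, k) times the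
    square of N - k. *)
Lemma binC_up k : (k < N)%N ->
  binC k.+1 * sqrtC ((N%:R - k%:R) * k.+1%:R) = binC k * (N%:R - k%:R).
Proof.
move=> kN; rewrite -natrB 1?ltnW //.
rewrite -sqrtCM ?nnegrE ?mulr_ge0 ?ler0n //.
rewrite mulrCA -natrM [('C(_, _) * _)%N]mulnC mul_bin_left natrM mulrA -expr2.
by rewrite mulrC sqrtCM ?nnegrE ?exprn_ge0 ?ler0n // sqrCK ?ler0n.
Qed.

Lemma binC_down k : (k < N)%N ->
  binC k * sqrtC (k.+1%:R * (N%:R - k%:R)) = binC k.+1 * k.+1%:R.
Proof.
move=> kN; rewrite -natrB 1?ltnW //.
rewrite -sqrtCM ?nnegrE ?mulr_ge0 ?ler0n //.
rewrite mulrCA -natrM [('C(_, _) * _)%N]mulnC -mul_bin_left natrM mulrA -expr2.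
by rewrite mulrC sqrtCM ?nnegrE ?exprn_ge0 ?ler0n // sqrCK ?ler0n.
Qed.

Lemma bargmann_Jplus v : bargmann (Jplus C N *m v) =
  N%:R *: ('X * bargmann v) - 'X^2 * (bargmann v)^`().
Proof.
apply/polyP => -[|k].
  by rewrite coefB coefZ coefXM coefXnM /= mulr0 subr0 (coef_bargmann _ ord0)
    mxE big1 ?mulr0 // => a _; rewrite mxE mul0r.
rewrite coefB coefZ coefXM coefXnM /=.
have -> : (if (k.+1 < 2)%N then 0 else ((bargmann v)^`())`_(k.+1 - 2)) =
    (bargmann v)`_k * k%:R.
  by case: k => [|k] /=; rewrite ?mulr0 // subn2 /= coef_deriv mulr_natr.
rewrite [N%:R * _]mulrC -mulrBr.
case: (ltnP k N) => kN; last first.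
  rewrite coef_poly ltnNge ltnS kN /=.
  (* At [k = N] the factor N - k vanishes; beyond it the coefficient does. *)
  move: kN; rewrite leq_eqVlt => /orP[/eqP ->|kN]; first by rewrite subrr mulr0.
  by rewrite coef_poly ltnNge kN mul0r.
have kS : (k.+1 < N.+1)%N by [].
rewrite (coef_bargmann _ (Ordinal kS)) (coef_bargmann _ (Ordinal (ltnW kS : (k < N.+1)%N))) /=.
rewrite mxE (bigD1 (Ordinal (ltnW kS : (k < N.+1)%N))) //= big1 ?addr0 => [|a ak].
  rewrite mxE /= eqxx spinBmag spinDmag /= natr1.
  by rewrite mulrA binC_up // mulrAC.
by rewrite mxE /= eqSS eq_sym (negPf (ak : (a != k :> nat))) mul0r.
Qed.

Lemma bargmann_Jminus v : bargmann (Jminus C N *m v) = (bargmann v)^`().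
Proof.
apply/polyP => k; rewrite coef_deriv.
case: (ltnP k N) => kN; last first.
  rewrite [in RHS]coef_poly ltnNge ltnS kN /= mul0rn.
  rewrite coef_poly; case: ifP => // kS; rewrite mxE big1 ?mulr0 // => a _.
  rewrite mxE inordK //; case: eqP => [E|]; rewrite ?mul0r //.
  by have := ltn_ord a; rewrite -E ltnS ltnNge kN.
have kS : (k.+1 < N.+1)%N by [].
rewrite (coef_bargmann _ (Ordinal kS)) (coef_bargmann _ (Ordinal (ltnW kS : (k < N.+1)%N))) /=.
rewrite mxE (bigD1 (Ordinal kS)) //= big1 ?addr0 => [|a ak].
  rewrite mxE /= eqxx spinBmag spinDmag /= -natr1 opprD addrA subrK natr1.
  by rewrite mulrA binC_down // mulrAC mulr_natr.
by rewrite mxE /= eq_sym (negPf (ak : (a != k.+1 :> nat))) mul0r.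
Qed.

(* The value at (u, v) of the form of degree M whose dehomogenization is p. *)
Definition homogenized M p (u v : {poly C}) : {poly C} :=
  \sum_(a < M.+1) p`_a *: (u ^+ a * v ^+ (M - a)).

(** Induction on the roots: multiplication by ['X] shifts the index and supplies a factor [u], while
    multiplication by the constant [c] keeps the index and supplies a factor [v]. *)
Lemma homogenized_prod (cs : seq C) (u v : {poly C}) :
  homogenized (size cs) (\prod_(c <- cs) ('X - c%:P)) u v =
  \prod_(c <- cs) (u - c *: v).
Proof.
rewrite /homogenized; elim: cs => [|c cs IHcs] /=.
  by rewrite !big_nil big_ord1 coef1 scale1r !expr0 mulr1.
rewrite !big_cons -IHcs; set p := \prod_(_ <- _) _; set M := size cs.
(* The sum without shift has one index too many, and its top coefficient vanishes by degree. *)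
have pM : p`_M.+1 = 0 by rewrite nth_default // size_prod_XsubC.
under eq_bigr do rewrite mulrBl coefB coefXM coefCM scalerBl.
rewrite sumrB big_ord_recl /= scale0r add0r [X in _ - X]big_ord_recr /=.
rewrite pM mulr0 scale0r addr0 mulrBl; congr (_ - _); rewrite mulr_sumr.
  by apply: eq_bigr => a _; rewrite /bump /= add1n /= subSS -scalerAr exprS mulrA.
apply: eq_bigr => a _; rewrite subSn; last by rewrite -ltnS.
by rewrite -scalerA -scalerAl -scalerAr exprS mulrCA.
Qed.

End Bargmann.

(** * Rotation about the y axis and dilation generated by [Jz] *)

Section Rotation.
Variables (R : realType) (N : nat).
Implicit Types (a b : 'I_N.+1).
Local Notation C := R[i].
Local Notation I := ('i%C : C).

Definition cis (y : R) : C := (cos y +i* sin y)%C.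

Lemma cisD y z : cis (y + z) = cis y * cis z.
Proof. by apply/eqP; rewrite eq_complex /= cosD sinD addrC [_ * sin z + _]addrC !eqxx. Qed.

Lemma cisMn y k : cis (k%:R * y) = cis y ^+ k.
Proof.
elim: k => [|k IHk].
  by rewrite mul0r expr0; apply/eqP; rewrite eq_complex /= cos0 sin0 !eqxx.
by rewrite -natr1 mulrDl mul1r cisD IHk exprSr.
Qed.

Definition eigenpoly (k : nat) : {poly C} :=
  ('X + I%:P) ^+ k * ('X - I%:P) ^+ (N - k).

(** This is (N - 2k) pi/4, split so that its [cis] is a product of powers of [cis (pi / 4)] and
    [cis (- (pi / 4))]. *)
Definition eigenangle (k : nat) : R := (N - k)%:R * (pi / 4) + k%:R * - (pi / 4).

Lemma size_linear_factors (x y : C) (n m : nat) :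
  size (('X - x%:P) ^+ n * ('X - y%:P) ^+ m) = (n + m).+1.
Proof.
by rewrite size_monicM ?monic_exp ?monicXsubC // ?size_exp_XsubC ?addnS //
  -size_poly_eq0 size_exp_XsubC.
Qed.

Lemma size_eigenpoly a : (size (eigenpoly a) <= N.+1)%N.
Proof.
rewrite /eigenpoly (_ : 'X + I%:P = 'X - (- I)%:P); last by rewrite polyCN opprK.
rewrite size_linear_factors.
by rewrite subnKC // -ltnS.
Qed.

Lemma sqrI : I * I = -1. Proof. by rewrite -expr2 sqr_i. Qed.

(** With u = X + i, v = X - i and d = N - a, X^2 + 1 = u v, so (X^2 + 1) times the derivative is (a
    v + d u) times the polynomial; N X - a v - d u is the constant (a - d) i. *)
Lemma eigenpoly_deriv a :
  N%:R *: ('X * eigenpoly a) - ('X^2 + 1) * (eigenpoly a)^`() =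
  ((a%:R - (N - a)%:R) * I) *: eigenpoly a.
Proof.
have aN : (a <= N)%N by rewrite -ltnS.
rewrite /eigenpoly derivM !deriv_exp derivD derivB derivX derivC addr0 subr0 !mul1r.
have II : I%:P * I%:P = -1 :> {poly C} by rewrite -polyCM sqrI polyCN.
have X1 : 'X^2 + 1 = ('X + I%:P) * ('X - I%:P) :> {poly C} by ring: II.
(* At [k = 0] the truncated predecessor is harmless, as the multiple is zero. *)
have powE (p : {poly C}) k : p * (p ^+ k.-1 *+ k) = p ^+ k *+ k.
  by case: k => [|k]; rewrite ?mulr0n ?mulr0 //= mulrnAr -exprS.
have -> : ('X^2 + 1) *
    (('X + I%:P) ^+ a.-1 *+ a * ('X - I%:P) ^+ (N - a) +
     ('X + I%:P) ^+ a * (('X - I%:P) ^+ (N - a).-1 *+ (N - a))) =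
    (('X - I%:P) *+ a + ('X + I%:P) *+ (N - a)) *
      (('X + I%:P) ^+ a * ('X - I%:P) ^+ (N - a)).
  rewrite X1 mulrDr.
  have := powE ('X + I%:P) a; have := powE ('X - I%:P) (N - a)%N.
  set u := 'X + I%:P; set v := 'X - I%:P.
  set u' := u ^+ a.-1 *+ a; set v' := v ^+ (N - a).-1 *+ (N - a).
  move=> v'E u'E.
  have -> : u * v * (u' * v ^+ (N - a)) = v * v ^+ (N - a) * (u * u') by ring.
  have -> : u * v * (u ^+ a * v') = u * u ^+ a * (v * v') by ring.
  by rewrite u'E v'E; ring.
rewrite -{1}(subnKC aN) natrD -!mul_polyC polyCM polyCB polyCD !polyC_natr.
ring.
Qed.

Definition eigenvectors : 'M[C]_N.+1 :=
  \matrix_(b, a) unbargmann N (eigenpoly a) b 0.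

Lemma col_eigenvectors a : col a eigenvectors = unbargmann N (eigenpoly a).
Proof. by apply/colP => b; rewrite !mxE. Qed.

(** The form (u + v)^b (u - v)^(N - b) at v = 1; its coefficients are, up to scale, the coordinates
    of [dicke C b] in the eigenbasis. *)
Definition dicke_poly (b : nat) : {poly C} := ('X + 1) ^+ b * ('X - 1) ^+ (N - b).

(** The denominator comes from X = (u + v) / 2 and 1 = (u - v) / (2i), where u = X + i and v = X -
    i; the root comes from the transform of [dicke C b]. *)
Definition dicke_scale b : C := sqrtC ('C(N, b)%:R : C) / (2 ^+ b * (2 * I) ^+ (N - b)).

Definition eigencoords : 'M[C]_N.+1 :=
  \matrix_(a, b) (dicke_scale b * (dicke_poly b)`_a).

(** Weighting the eigenvectors by [w ^+ a * z ^+ (N - a)] amounts to scaling the arguments of the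
    form by [w] and [z]. The weights 1 give the inverse matrix, and unit phases give the
    rotation. *)
Lemma bargmann_eigenvectors (w z : C) (e : 'rV[C]_N.+1) b :
  (forall a, e 0 a = w ^+ a * z ^+ (N - a)) ->
  bargmann (eigenvectors *m diag_mx e *m eigencoords *m dicke C b) =
  dicke_scale b *:
    ((w *: ('X + I%:P) + z *: ('X - I%:P)) ^+ b *
     (w *: ('X + I%:P) - z *: ('X - I%:P)) ^+ (N - b)).
Proof.
move=> eE; set u := w *: _; set v := z *: _.
have bN : (b <= N)%N by rewrite -ltnS.
have -> : eigenvectors *m diag_mx e *m eigencoords *m dicke C b =
    \sum_a (e 0 a * eigencoords a b) *: col a eigenvectors.
  rewrite /dicke -colE; apply/colP => i; rewrite mxE mxE summxE.
  by apply: eq_bigr => a _; rewrite mul_mx_diag !mxE; ring.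
rewrite linear_sum.
have -> : (u + v) ^+ b * (u - v) ^+ (N - b) = homogenized N (dicke_poly b) u v.
  pose cs : seq C := nseq b (-1) ++ nseq (N - b) 1.
  have szE : size cs = N by rewrite size_cat !size_nseq subnKC.
  have -> : dicke_poly b = \prod_(c <- cs) ('X - c%:P).
    by rewrite /dicke_poly big_cat !big_nseq !iter_mulr_1 polyCN opprK.
  have := homogenized_prod cs u v; rewrite szE => ->.
  by rewrite big_cat !big_nseq !iter_mulr_1 scaleN1r opprK scale1r.
rewrite /homogenized scaler_sumr; apply: eq_bigr => a _.
rewrite linearZ /= col_eigenvectors unbargmannK ?size_eigenpoly //.
have -> : u ^+ a * v ^+ (N - a) = (w ^+ a * z ^+ (N - a)) *: eigenpoly a.
  by rewrite /u /v !exprZn -scalerAl -scalerAr scalerA.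
by rewrite eE mxE !scalerA; congr (_ *: _); ring.
Qed.

Lemma eigenvectorsK : eigenvectors *m eigencoords = 1%:M.
Proof.
apply/matrixP => i b.
have bN : (b <= N)%N by rewrite -ltnS.
suff E : eigenvectors *m eigencoords *m dicke C b = dicke C b.
  by move/colP/(_ i): E; rewrite -colE !mxE andbT.
apply: bargmann_inj.
have e1 a : (const_mx 1 : 'rV[C]_N.+1) 0 a = 1 ^+ a * 1 ^+ (N - a).
  by rewrite mxE !expr1n mulr1.
have := bargmann_eigenvectors b e1; rewrite diag_const_mx mulmx1 => ->.
rewrite bargmann_dicke !scale1r.
have -> : 'X + I%:P + ('X - I%:P) = 2 *: 'X :> {poly C}.
  by rewrite addrACA subrr addr0 scaler_nat mulr2n.
have -> : 'X + I%:P - ('X - I%:P) = (2 * I)%:P :> {poly C}.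
  by rewrite opprB addrACA addrA addrC addrA addrAC; rewrite mulrDl mul1r polyCD; ring.
rewrite exprZn -polyC_exp [_ * _%:P]mulrC mul_polyC !scalerA /dicke_scale.
congr (_ *: _); rewrite -mulrA [(2 * I) ^+ _ * _]mulrC divfK //.
by rewrite mulf_neq0 // expf_neq0 // ?mulf_neq0 ?pnatr_eq0 // complexiE neq0Ci.
Qed.

(** The prefactor is (- i pi/2) / (2i) = - pi/4, and [Jplus - Jminus] has the eigenvalue (2a - N) i
    by [eigenpoly_deriv]. *)
Lemma rotation_eigenvectors :
  (- ('i * pi%:C%C / 2) *: Jy C N) *m eigenvectors =
  eigenvectors *m diag_mx (\row_a (0 +i* eigenangle a)%C).
Proof.
apply/matrixP => i a.
suff E : col a ((- ('i * pi%:C%C / 2) *: Jy C N) *m eigenvectors) =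
    (0 +i* eigenangle a)%C *: col a eigenvectors.
  move/colP/(_ i): E; rewrite [LHS]mxE => ->.
  by rewrite mul_mx_diag !mxE mulrC.
rewrite colE -mulmxA -colE col_eigenvectors; apply: bargmann_inj.
have bargmannZ c v : bargmann (c *: v : 'cV[C]_N.+1) = c *: bargmann v.
  exact: linearZ.
rewrite /Jy scalerA -scalemxAl !bargmannZ mulmxBl linearB /=.
rewrite bargmann_Jplus bargmann_Jminus unbargmannK ?size_eigenpoly //.
set P := eigenpoly a.
have -> : N%:R *: ('X * P) - 'X^2 * P^`() - P^`() =
    N%:R *: ('X * P) - ('X^2 + 1) * P^`() by ring.
rewrite eigenpoly_deriv scalerA; congr (_ *: _).
have -> : (0 +i* eigenangle a)%C = I * (eigenangle a)%:C%C by simpc.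
rewrite -complexiE /eigenangle; move: (pi : R) => t.
rewrite rmorphD!rmorphM rmorphN rmorphM fmorphV !rmorph_nat.
by field; rewrite complexiE neq0Ci.
Qed.

Lemma cos_pi4 : cos (pi / 4) = sin (pi / 4) :> R.
Proof.
have := tan_piquarter R; rewrite /tan => t1.
have c0 : cos (pi / 4) != 0 :> R.
  by apply/eqP => c0; move: t1; rewrite c0 invr0 mulr0 => /esym/eqP; rewrite oner_eq0.
by move/(congr1 ( *%R^~ (cos (pi / 4)))): t1; rewrite divfK // mul1r.
Qed.

(** The phases are q (1 - i) and q (1 + i) with q = cos(pi/4); the scaled X + i and X - i then have
    sum 2q (X + 1) and difference - 2qi (X - 1). *)
Lemma bargmann_rotation b : exists c : C,
  bargmann (expmx (- ('i * pi%:C%C / 2) *: Jy C N) *m dicke C b) =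
  c *: (('X + 1) ^+ b * ('X - 1) ^+ (N - b)).
Proof.
pose e : 'rV[C]_N.+1 := \row_a cis (eigenangle a).
rewrite (expmx_diagonalized (e := e) rotation_eigenvectors eigenvectorsK); last first.
  by move=> a; rewrite !mxE; exact: cvg_exps_imaginary.
rewrite (@bargmann_eigenvectors (cis (- (pi / 4))) (cis (pi / 4))); last first.
  by move=> a; rewrite mxE cisD !cisMn mulrC.
pose q : C := (cos (pi / 4))%:C%C.
have -> : cis (- (pi / 4)) = q * (1 - I).
  by rewrite /cis cosN sinN -cos_pi4; simpc.
have -> : cis (pi / 4) = q * (1 + I).
  by rewrite /cis -cos_pi4; simpc.
have II : I%:P * I%:P = -1 :> {poly C} by rewrite -polyCM sqrI polyCN.
have -> : (q * (1 - I)) *: ('X + I%:P) + (q * (1 + I)) *: ('X - I%:P) =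
    (2 * q) *: ('X + 1).
  rewrite -!mul_polyC !polyCM polyCB polyCD !polyC1 polyC_natr.
  by ring: II.
have -> : (q * (1 - I)) *: ('X + I%:P) - (q * (1 + I)) *: ('X - I%:P) =
    (- (2 * q * I)) *: ('X - 1).
  rewrite -!mul_polyC polyCN !polyCM polyCB polyCD !polyC1 polyC_natr.
  by ring: II.
by rewrite !exprZn -scalerAl -scalerAr !scalerA; eexists.
Qed.

(** [Jz] is already diagonal, and exp(t (a - N/2)) splits into a common factor and the a-th power of
    exp(t), which is absorbed into [z]. *)
Lemma expmx_Jz (t : R) (v : 'cV[C]_N.+1) (z : C) :
  (bargmann (expmx (t%:C%C *: Jz C N) *m v)).[z] =
  (expR (- (t * (N%:R / 2))))%:C%C * (bargmann v).[(expR t)%:C%C * z].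
Proof.
pose l : 'rV[C]_N.+1 := \row_a (t * (a%:R - N%:R / 2))%:C%C.
pose e : 'rV[C]_N.+1 := \row_a (expR (t * (a%:R - N%:R / 2)))%:C%C.
have JE : (t%:C%C *: Jz C N) *m 1%:M = 1%:M *m diag_mx l.
  rewrite mulmx1 mul1mx; apply/matrixP => i j; rewrite !mxE.
  case: eqVneq => [->|_]; last by rewrite mulr0.
  by rewrite mulr1n rmorphM rmorphB rmorphM fmorphV !rmorph_nat.
rewrite (expmx_diagonalized (e := e) JE (mulmx1 _)); last first.
  by move=> a; rewrite !mxE; exact: cvg_exps_real.
rewrite mul1mx mulmx1 !horner_poly mulr_sumr; apply: eq_bigr => a _.
rewrite inord_val mul_diag_mx !mxE mulrBr addrC expRD expRM_natr.
by rewrite rmorphM rmorphXn /= exprMn; ring.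
Qed.

End Rotation.

(** * The density operator and the symbol of its square root *)

Section DensityOperator.
Variables (R : realType) (N : nat) (s : R).
Hypotheses (s0 : 0 <= s) (s1 : s < 1).
Local Notation C := R[i].

Let weight : R := (1 - s ^+ 2) / (1 - s ^+ (2 * N + 2)).

Let num_gt0 : 0 < 1 - s ^+ 2.
Proof. by rewrite subr_gt0 exprn_ilt1. Qed.

Let den_gt0 : 0 < 1 - s ^+ (2 * N + 2).
Proof. by rewrite subr_gt0 exprn_ilt1 // addn2. Qed.

Let weight_ge0 : 0 <= weight.
Proof. by rewrite divr_ge0 ?ltW. Qed.

(** The power of [s] is grouped as a square so that its root can be read off. *)
Let rho_diag : 'rV[C]_N.+1 := \row_a (weight * (s ^+ (N - a)) ^+ 2)%:C%C.

Lemma rho_diag_mx : rho N s = diag_mx rho_diag.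
Proof.
apply/matrixP => i j; rewrite !mxE summxE.
under eq_bigr => a _.
  rewrite mxE /ketbra mxE big_ord1 !mxE andbT conjC_nat.
  over.
rewrite (bigD1 i) //= big1 ?addr0 => [|a ai]; last first.
  by rewrite [i == a]eq_sym (negPf ai) mul0r mulr0.
rewrite eqxx mul1r andbT [j == i]eq_sym; case: (i == j); last first.
  by rewrite !mulr0 mulr0n.
rewrite mulr1 mulr1n -exprM [((_ - _) * 2)%N]mulnC.
by rewrite [RHS]rmorphM.
Qed.

(** Reversing the index makes the trace a geometric sum of ratio s^2, whose value is the inverse of
    [weight]. *)
Lemma is_density_rho : is_density (rho N s).
Proof.
rewrite rho_diag_mx; split.
  apply: is_psd_diag_mx => a.
  by rewrite mxE ler0c mulr_ge0 // exprn_ge0 // exprn_ge0.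
rewrite mxtrace_diag.
under eq_bigr do rewrite mxE.
rewrite -rmorph_sum -mulr_sumr /=.
have -> : \sum_(a < N.+1) (s ^+ (N - a)) ^+ 2 = \sum_(a < N.+1) (s ^+ 2) ^+ a.
  rewrite (reindex_inj rev_ord_inj) /=; apply: eq_bigr => a _.
  by rewrite subSS subKn -1?ltnS // -!exprM mulnC.
have := subrX1 (s ^+ 2) N.+1; rewrite -exprM mulnS addnC => E.
rewrite /weight mulrAC -[_ * \sum_(_ < _) _]opprK -mulNr opprB -E opprB divff //.
by rewrite gt_eqF.
Qed.

Lemma wick_sqrt_rho (xi eta : C) :
  wick (sqrtmx (rho N s)) xi eta =
  (Num.sqrt weight)%:C%C * (xi^* * eta + s%:C%C) ^+ N.
Proof.
rewrite rho_diag_mx sqrtmx_diag_mx wick_diag_mx addrC exprDn mulr_sumr.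
apply: eq_bigr => a _; rewrite !mxE sqrtC_real_complex; last first.
  by rewrite mulr_ge0 // exprn_ge0 // exprn_ge0.
rewrite sqrtrM // sqrtr_sqr ger0_norm ?exprn_ge0 // rmorphM rmorphXn /=.
by rewrite mulrnAr mulrA.
Qed.

End DensityOperator.

(** * The symbol of the projector onto the rotated and dilated state *)

Lemma bargmann_phi (R : realType) (N : nat) (k : R) (A : R[i]) (n : 'I_N.+1) :
  0 < k -> exists c : R[i], forall z,
    (bargmann (phi k A n)).[z] =
    c * ((z + (Num.sqrt k)%:C%C) ^+ n * (z - (Num.sqrt k)%:C%C) ^+ (N - n)).
Proof.
move=> k0; have [c cE] := bargmann_rotation R n.
set t : R := - (2^-1 * ln k).
have sqrtkE : expR t * Num.sqrt k = 1.
  have -> : Num.sqrt k = expR (- t).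
    have -> : k = expR (- t) ^+ 2.
      by rewrite -expRM_natl opprK mulrA divff ?pnatr_eq0 // mul1r lnK.
    by rewrite sqrtr_sqr ger0_norm ?expR_ge0.
  by rewrite -expRD subrr expR0.
have nN : (n <= N)%N by rewrite -ltnS.
(* Each of the N linear factors releases one exp(t), since exp(t) z + 1 = exp(t) (z + sqrt k) and
   likewise with minus signs. *)
exists (A * ((expR (- (t * (N%:R / 2))))%:C%C * (c * (expR t)%:C%C ^+ N))) => z.
rewrite /phi linearZ /= hornerZ -mulmxA expmx_Jz cE -!mulrA; congr (_ * (_ * _)).
have sC : (expR t)%:C%C * (Num.sqrt k)%:C%C = 1 :> R[i].
  by rewrite -rmorphM sqrtkE.
have -> : (expR t)%:C%C ^+ N = (expR t)%:C%C ^+ n * (expR t)%:C%C ^+ (N - n) :> R[i].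
  by rewrite -exprD subnKC.
rewrite !hornerE -/t -sC -mulrDr -mulrBr !exprMn.
by rewrite /=; ring.
Qed.

Unset Implicit Arguments.

Theorem mainTheorem4 (R : realType) (N : nat) (hN : (0 < N)%N) :
  (forall s : R, 0 <= s -> s < 1 ->
     is_density (rho N s) /\
     forall xi eta : R[i],
       wick (sqrtmx (rho N s)) xi eta
       = (Num.sqrt ((1 - s ^+ 2) / (1 - s ^+ (2 * N + 2))))%:C%C
         * (xi^* * eta + s%:C%C) ^+ N)
  /\
  (forall (k : R) (n : 'I_N.+1) (A : R[i]), 0 < k ->
     braket (phi k A n) (phi k A n) = 1 ->
     exists c : R[i], forall xi eta : R[i],
       wick (ketbra (phi k A n) (phi k A n)) xi eta
       = c * (xi^* + (Num.sqrt k)%:C%C) ^+ n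
           * (xi^* - (Num.sqrt k)%:C%C) ^+ (N - n)
           * (eta + (Num.sqrt k)%:C%C) ^+ n
           * (eta - (Num.sqrt k)%:C%C) ^+ (N - n)).
Proof.
split=> [s s0 s1|k n A k0 _].
  by split=> [|xi eta]; [exact: is_density_rho | exact: wick_sqrt_rho].
have [c cE] := bargmann_phi A n k0.
(* The second factor is the conjugate of the transform at [eta^*]; as sqrt k is real, conjugation
   restores [eta] and leaves [c^*]. *)
exists (c * c^*) => xi eta; rewrite wick_ketbra !cE.
have sqrtkC : ((Num.sqrt k)%:C%C : R[i])^* = (Num.sqrt k)%:C%C.
  by apply/CrealP/ger0_real; rewrite ler0c sqrtr_ge0.
rewrite !rmorphM !rmorphXn rmorphD rmorphB /= conjCK sqrtkC.
by ring.
Qed.
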